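(* Let $G$ be a connected graph with $n$ vertices and $k \in [n]$. The following statements are equivalent: (1) $G$ has a pinnacle set of size $k$. (2) The set $M_{n,k} = \{n-k+1, \ldots, n-1, n\}$ is a pinnacle set of $G$. (3) $G$ has an independent set of size $k$.
   Context: Graphs are finite and simple, and $[n] = \{1,2,\ldots,n\}$. A labeling of a graph $G$ with $n$ vertices is a bijection $\lambda : V(G) \to [n]$. The label $\lambda(u)$ of a vertex $u$ is a pinnacle of $(G,\lambda)$ if $\lambda(u) > \lambda(v)$ for every neighbor $v$ of $u$ (so the label of an isolated vertex is vacuously a pinnacle). The pinnacle set of $(G,\lambda)$ is the set of all pinnacles of $(G,\lambda)$. A subset $S \subseteq [n]$ is a pinnacle set of $G$ if there is a labeling $\lambda$ of $G$ such that $S$ is the pinnacle set of $(G,\lambda)$. *)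

(* Defs.v *)
From mathcomp Require Import all_boot.
From mathcomp Require Import finmap.

Set Implicit Arguments.
Unset Strict Implicit.
Unset Printing Implicit Defensive.

Local Open Scope fset_scope.

(* A finite simple graph is a finType of vertices with an adjacency relation
   satisfying [simple_graph]. *)
Definition simple_graph (V : finType) (adj : rel V) : Prop :=
  symmetric adj /\ irreflexive adj.

(* The null graph is not considered connected. *)
Definition connected_graph (V : finType) (adj : rel V) : Prop :=
  0 < #|V| /\ forall u v : V, connect adj u v.

Definition independent (V : finType) (adj : rel V) (A : {set V}) : Prop :=
  {in A &, forall u v : V, ~~ adj u v}.

(* [n] = {1, ..., n} *)
Definition interval1 (n : nat) : {fset nat} := [fset m in iota 1 n].

(* Labels are natural numbers; the two conditions say that lambda is a
   bijection from V onto {1, ..., #|V|}. *)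
Definition labeling (V : finType) (lambda : V -> nat) : Prop :=
  injective lambda /\ [fset lambda u | u in V] = interval1 #|V|.

Definition has_pinnacle_at (V : finType) (adj : rel V) (lambda : V -> nat)
    (u : V) : bool :=
  [forall v, adj u v ==> (lambda v < lambda u)].

Definition pinnacles (V : finType) (adj : rel V) (lambda : V -> nat) :
    {fset nat} :=
  [fset lambda u | u in V & has_pinnacle_at adj lambda u].

Definition pinnacle_set (V : finType) (adj : rel V) (S : {fset nat}) : Prop :=
  S `<=` interval1 #|V| /\
  exists lambda : V -> nat, labeling lambda /\ S = pinnacles adj lambda.

(* {n - k + 1, ..., n} for k <= n: the list iota a k is a, ..., a + k - 1. *)
Definition top_labels (n k : nat) : {fset nat} := [fset m in iota (n - k + 1) k].

(* Main.v *)
Require Import Defs.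
From mathcomp Require Import all_boot.
From mathcomp Require Import finmap zify.

(** Two adjacent vertices cannot both carry a pinnacle, so the vertices of the
    pinnacles form an independent set of the same size as the pinnacle set.

    Conversely, let [A] be a nonempty independent set. Starting from [A], add
    the other vertices one at a time, each adjacent to a vertex already
    present; connectedness allows this to go on until every vertex has been
    reached ([search_order]). Hand out the labels [n], [n - 1], ..., 1 in that
    order. A vertex of [A] has all its neighbors outside [A], hence later in
    the order and with smaller labels, so it is a pinnacle; a vertex outside
    [A] has an earlier neighbor, with a larger label, so it is not. The
    pinnacles are therefore exactly the labels of [A], that is, the [#|A|]
    largest ones. *)

Set Implicit Arguments.
Unset Strict Implicit.
Unset Printing Implicit Defensive.

Lemma mem_interval1 n m : (m \in interval1 n) = (0 < m <= n).
Proof. by rewrite /interval1 in_fset /= mem_iota add1n ltnS. Qed.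

Lemma mem_top_labels n k m : k <= n ->
  (m \in top_labels n k) = (n - k < m <= n).
Proof. by move=> le_kn; rewrite /top_labels in_fset /= mem_iota; lia. Qed.

Lemma card_top_labels n k : #|` top_labels n k|%fset = k.
Proof.
rewrite /top_labels card_fseq undup_id ?iota_uniq //.
by rewrite size_iota.
Qed.

Section Graph.

Variables (V : finType) (adj : rel V).

Lemma pinnacles_independent (lambda : V -> nat) : symmetric adj ->
  independent adj [set u | has_pinnacle_at adj lambda u].
Proof.
move=> adj_sym u v; rewrite !inE => /forallP/(_ v) pu /forallP/(_ u) pv.
apply/negP => uv; move: pu pv; rewrite (adj_sym v) uv /=; lia.
Qed.

Lemma card_pinnacles (lambda : V -> nat) : injective lambda ->
  #|` pinnacles adj lambda|%fset = #|[set u | has_pinnacle_at adj lambda u]|.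
Proof.
move=> lambda_inj; rewrite /pinnacles card_imfset //= cardE.
apply: perm_size; apply: uniq_perm => [||u].
- by rewrite filter_uniq // enum_uniq.
- exact: enum_uniq.
by rewrite mem_filter !mem_enum !inE andbT.
Qed.

Lemma connected_boundary_edge (s : seq V) (x y : V) :
  connect adj x y -> x \in s -> y \notin s ->
  exists u v, [/\ u \in s, v \notin s & adj u v].
Proof.
case/connectP=> p; elim: p x => [|z p IHp] x /=; first by move=> _ -> ->.
case/andP=> xz zp def_y xs ys; case: (boolP (z \in s)) => [zs|zNs].
  exact: IHp zs ys.
by exists x, z.
Qed.

(** While a vertex is missing, a path from [A] to it leaves the current prefix
    along some edge, whose far end can be appended: its earlier neighbor is the
    near end, and the vertices already present keep their indices. *)
Lemma search_prefix (A : {set V}) m :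
  symmetric adj -> (forall u v, connect adj u v) -> 0 < #|A| -> #|A| + m <= #|V| ->
  exists t, [/\ size t = m, uniq (enum A ++ t) &
    forall v, v \in t -> exists2 u, adj v u &
      index u (enum A ++ t) < index v (enum A ++ t)].
Proof.
move=> adj_sym conn A_gt0; elim: m => [|m IHm] le_m.
  by exists [::]; split; rewrite // cats0 enum_uniq.
have [|t [size_t uniq_s early]] := IHm; first by lia.
set s := enum A ++ t in uniq_s early.
have size_s : size s = #|A| + m by rewrite size_cat -cardE size_t.
have [x xA] : exists x, x \in A by apply/set0Pn; rewrite -card_gt0.
have xs : x \in s by rewrite mem_cat mem_enum xA.
have [y ys] : exists y, y \notin s.
  apply/existsP; rewrite -negb_forall; apply/negP => /forallP all_s.
  have : #|V| <= size s.
    rewrite cardE; apply: uniq_leq_size; first exact: enum_uniq.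
    by move=> z _; apply: all_s.
  by rewrite size_s; lia.
have [u [v [us vs uv]]] := connected_boundary_edge (conn x y) xs ys.
exists (rcons t v); rewrite -rcons_cat -/s; split.
- by rewrite size_rcons size_t.
- by rewrite rcons_uniq vs.
move=> w; rewrite mem_rcons inE => /predU1P[->|wt].
  exists u; first by rewrite adj_sym.
  by rewrite -cats1 !(index_cat _ s) us (negbTE vs) ltn_addr ?index_mem.
have [z wz lt_zw] := early w wt; exists z => //.
have ws : w \in s by rewrite mem_cat wt orbT.
have zs : z \in s by rewrite -index_mem (ltn_trans lt_zw) // index_mem.
by rewrite -cats1 !(index_cat _ s) ws zs.
Qed.

Lemma search_order (A : {set V}) :
  symmetric adj -> (forall u v, connect adj u v) -> 0 < #|A| ->
  exists s : seq V, [/\ uniq s, forall v, v \in s,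
    forall v, (v \in A) = (index v s < #|A|) &
    forall v, v \notin A -> exists2 u, adj v u & index u s < index v s].
Proof.
move=> adj_sym conn A_gt0; have le_AV : #|A| + (#|V| - #|A|) <= #|V|.
  by rewrite subnKC // max_card.
have [t [size_t uniq_s early]] := search_prefix adj_sym conn A_gt0 le_AV.
have size_s : size (enum A ++ t) = #|V|.
  by rewrite size_cat -cardE size_t subnKC // max_card.
have mem_s v : v \in enum A ++ t.
  have [] := uniq_min_size uniq_s (s2 := enum V).
  - by move=> z _; rewrite mem_enum.
  - by rewrite -cardE size_s.
  by move=> _ ->; rewrite mem_enum.
exists (enum A ++ t); split => // v.
  rewrite index_cat mem_enum; case: ifP => vA.
    by rewrite cardE index_mem mem_enum vA.
  by rewrite -cardE ltnNge leq_addr.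
by move=> vA; apply: early; move: (mem_s v); rewrite mem_cat mem_enum (negbTE vA).
Qed.

Lemma size_exhaustive (s : seq V) :
  uniq s -> (forall v, v \in s) -> size s = #|V|.
Proof. by move=> /card_uniqP <- mem_s; apply: eq_card => v; rewrite mem_s. Qed.

(** Labels decrease along the order, so that the first vertices get the
    largest labels. *)
Lemma labeling_of_order (s : seq V) : uniq s -> (forall v, v \in s) ->
  labeling (fun v => size s - index v s).
Proof.
move=> uniq_s mem_s.
rewrite /labeling -(size_exhaustive uniq_s mem_s).
have lt_index v : index v s < size s by rewrite index_mem.
split=> [u v /= eq_uv|].
  apply: (index_inj u (mem_s u) (mem_s v)).
  by rewrite /=; have := lt_index u; have := lt_index v; lia.
apply/fsetP=> m; rewrite mem_interval1.
apply/imfsetP/idP => /= [[v _ ->]|/andP[m_gt0 le_ms]].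
  by have := lt_index v; lia.
have /card_gt0P[v0 _] : 0 < #|V|.
  by rewrite -(size_exhaustive uniq_s mem_s) (leq_trans m_gt0).
(* [m] is the label of the vertex at position [size s - m]. *)
exists (nth v0 s (size s - m)) => //.
by rewrite index_uniq ?subKn // ltn_subrL m_gt0 (leq_trans m_gt0).
Qed.

Lemma independent_pinnacle_set (A : {set V}) :
  symmetric adj -> (forall u v, connect adj u v) ->
  0 < #|A| -> independent adj A ->
  pinnacle_set adj (top_labels #|V| #|A|).
Proof.
move=> adj_sym conn A_gt0 indA.
have [s [uniq_s mem_s A_first early]] := search_order adj_sym conn A_gt0.
have size_s := size_exhaustive uniq_s mem_s.
have lab := labeling_of_order uniq_s mem_s.
have le_As : #|A| <= size s by rewrite size_s max_card.
have lt_index v : index v s < size s by rewrite index_mem.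
rewrite /pinnacle_set -size_s; split.
  by apply/fsubsetP=> m; rewrite mem_top_labels // mem_interval1; lia.
exists (fun v => size s - index v s); split=> //.
have pinA v : has_pinnacle_at adj (fun v => size s - index v s) v = (v \in A).
  apply/forallP/idP => [pv|vA u].
    apply: contraT => /early[u vu lt_uv].
    by have := pv u; rewrite vu /=; have := lt_index v; lia.
  apply/implyP => vu; have uA : u \notin A.
    by apply/negP => uA; have := indA v u vA uA; rewrite vu.
  by move: vA uA; rewrite !A_first; have := lt_index u; lia.
apply/fsetP=> m; rewrite mem_top_labels //.
apply/idP/imfsetP => /= [m_top|[v]].
  have : m \in interval1 #|V| by rewrite -size_s mem_interval1; lia.
  rewrite -lab.2 => /imfsetP[v _ /= def_m]; exists v => //.
  by rewrite !inE /= pinA A_first; move: m_top; rewrite def_m; lia.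
rewrite !inE /= pinA A_first => vA ->.
by have := lt_index v; lia.
Qed.

End Graph.

Theorem corollary2p5p1 (V : finType) (adj : rel V) (n k : nat)
    (hG : simple_graph adj) (hconn : connected_graph adj)
    (hn : #|V| = n) (hk : 1 <= k <= n) :
  ((exists S : {fset nat}, pinnacle_set adj S /\ #|` S|%fset = k)
     <-> pinnacle_set adj (top_labels n k)) /\
  (pinnacle_set adj (top_labels n k)
     <-> exists A : {set V}, independent adj A /\ #|A| = k).
Proof.
have ind_of_pin S : pinnacle_set adj S -> #|` S|%fset = k ->
    exists A : {set V}, independent adj A /\ #|A| = k.
  case=> _ [lambda [[lambda_inj _] ->]] <-.
  exists [set u | has_pinnacle_at adj lambda u].
  by split; [apply: pinnacles_independent; case: hG | rewrite card_pinnacles].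
have top_of_ind : (exists A : {set V}, independent adj A /\ #|A| = k) ->
    pinnacle_set adj (top_labels n k).
  case=> A [indA cardA]; rewrite -hn -cardA.
  by apply: independent_pinnacle_set hG.1 hconn.2 _ indA; rewrite cardA; case/andP: hk.
split; split=> //.
- by case=> S [pinS cardS]; apply: top_of_ind; apply: ind_of_pin cardS.
- by exists (top_labels n k); rewrite card_top_labels.
- by move=> pin; apply: ind_of_pin pin _; rewrite card_top_labels.
Qed.
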